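(* Let $r=\sqrt{3(t+2)(t+7)(3t^2+3t+2)}$. The functions $$T_{43}=\frac12+\frac{27t^{10}+270t^9+945t^8+2160t^7+2745t^6+1926t^5-5t^4-1340t^3-1440t^2-720t-216}{6(t+2)^2(t^2+1)^2(3t^2+3t+2)\,r},$$ $$y_{43}=\frac12+\frac{t+7}{18(t^2+1)}\cdot\frac{135t^9+540t^8+1530t^7+2916t^6+3714t^5+3486t^4+2278t^3+1144t^2+399t+114}{(5t^6+30t^5+45t^4+22t^3-13t^2-16t-9)\,r}$$ (with the same branch of $r$ in both) parametrize an algebraic solution $y_{43}(T_{43})$ of the sixth Painlev\'e equation $P_{VI}(1/3,1/3,1/2,2/5;T_{43})$.
   Context: $P_{VI}(\theta_0,\theta_1,\theta_T,\theta_\infty;T)$ denotes the sixth Painlev\'e equation $$\begin{aligned}\frac{d^2y}{dT^2}={}&\frac12\left(\frac1y+\frac1{y-1}+\frac1{y-T}\right)\left(\frac{dy}{dT}\right)^2-\left(\frac1T+\frac1{T-1}+\frac1{y-T}\right)\frac{dy}{dT}\\&+\frac{y(y-1)(y-T)}{T^2(T-1)^2}\left(\alpha+\beta\frac{T}{y^2}+\gamma\frac{T-1}{(y-1)^2}+\delta\frac{T(T-1)}{(y-T)^2}\right)\end{aligned}$$ for $y=y(T)$, with $\alpha=\frac{(\theta_\infty-1)^2}{2}$, $\beta=-\frac{\theta_0^2}{2}$, $\gamma=\frac{\theta_1^2}{2}$, $\delta=\frac{1-\theta_T^2}{2}$. That functions $T$ and $y$ on the algebraic curve with coordinates $(t,r)$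 parametrize a solution means that $T$ is non-constant and that $y$, viewed locally as a function of $T$, satisfies the equation. *)

(* Defs.v *)
From HB Require Import structures.
From mathcomp Require Import all_boot all_order all_algebra.
From mathcomp Require Import complex.
From mathcomp Require Import all_classical all_reals all_analysis.

Set Implicit Arguments.
Unset Strict Implicit.
Unset Printing Implicit Defensive.

Import Order.TTheory GRing.Theory Num.Theory.
Import numFieldNormedType.Exports.

Local Open Scope classical_set_scope.
Local Open Scope ring_scope.

Section PainleveVI.
Variable K : numFieldType.
Implicit Types (W : set K) (Y : K -> K) (x : K).

(* The sixth Painleve equation for [Y] at the point [x].  Both derivatives are
   total functions in the library, with junk values where they do not exist, and
   division by zero gives zero; [PVI_solution] below excludes these cases. *)
Definition PVI_eq (th0 th1 thT thoo : K) Y x : Prop :=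
  let alpha := (thoo - 1) ^+ 2 / 2 in
  let beta := - (th0 ^+ 2 / 2) in
  let gamma := th1 ^+ 2 / 2 in
  let delta := (1 - thT ^+ 2) / 2 in
  let y := Y x in
  let dy := (Y^`())%classic x in
  let ddy := (Y^`(2))%classic x in
  ddy =
    1 / 2 * (1 / y + 1 / (y - 1) + 1 / (y - x)) * dy ^+ 2
    - (1 / x + 1 / (x - 1) + 1 / (y - x)) * dy
    + y * (y - 1) * (y - x) / (x ^+ 2 * (x - 1) ^+ 2) *
      (alpha + beta * (x / y ^+ 2) + gamma * ((x - 1) / (y - 1) ^+ 2)
       + delta * (x * (x - 1) / (y - x) ^+ 2)).

(* [derivable _ x 1] is differentiability in the variable of [K], i.e. complex
   differentiability when [K] is the field of complex numbers. *)
Definition PVI_solution (th0 th1 thT thoo : K) W Y : Prop :=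
  open W /\
  forall x, W x ->
    [/\ derivable Y x 1 /\ derivable (Y^`())%classic x 1,
        x != 0 /\ x != 1,
        [/\ Y x != 0, Y x != 1 & Y x != x]
      & PVI_eq th0 th1 thT thoo Y x].

Definition generically (X : set (K * K)) (P : K * K -> Prop) : Prop :=
  finite_set (X `\` [set p | P p]).

(* Rational functions [T] and [y] on the plane curve [X] are given as total
   functions of the coordinates; their values at the finitely many poles, being
   junk, are irrelevant to "generically".

   At all but finitely many points [p] of [X], the function [y], viewed near [p]
   as a function [Y] of [T], solves the equation.  The solution is algebraic: a
   single nonzero polynomial relation [F(x, Y(x)) = 0] holds for all these local
   branches [Y].  [F.[u, v]] substitutes [u] for the outer variable and [v] for
   the inner (coefficient) variable. *)
Definition parametrizes_algebraic_PVI_solution (th0 th1 thT thoo : K)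
    (X : set (K * K)) (T y : K * K -> K) : Prop :=
  (forall c : K, ~ generically X (fun p => T p = c)) /\
  exists2 F : {poly {poly K}}, F != 0 &
    generically X (fun p =>
      exists (W : set K) (Y : K -> K),
        [/\ W (T p),
            PVI_solution th0 th1 thT thoo W Y,
            forall x, W x -> F.[x, Y x] = 0
          & \forall q \near within X (nbhs p), W (T q) /\ y q = Y (T q)]).

End PainleveVI.

Section Solution43.
Variable K : numFieldType.

(* Points are pairs [(t, r)]; both choices of the square root [r] lie on the
   curve. *)
Definition curve43 : set (K * K) :=
  [set p | let t := p.1 in let r := p.2 in
     r ^+ 2 = 3 * (t + 2) * (t + 7) * (3 * t ^+ 2 + 3 * t + 2)].

Definition T43 (p : K * K) : K :=
  let t := p.1 in let r := p.2 in
  1 / 2 +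
  (27 * t ^+ 10 + 270 * t ^+ 9 + 945 * t ^+ 8 + 2160 * t ^+ 7 + 2745 * t ^+ 6
   + 1926 * t ^+ 5 - 5 * t ^+ 4 - 1340 * t ^+ 3 - 1440 * t ^+ 2 - 720 * t
   - 216)
  / (6 * (t + 2) ^+ 2 * (t ^+ 2 + 1) ^+ 2 * (3 * t ^+ 2 + 3 * t + 2) * r).

Definition y43 (p : K * K) : K :=
  let t := p.1 in let r := p.2 in
  1 / 2 +
  (t + 7) / (18 * (t ^+ 2 + 1)) *
  ((135 * t ^+ 9 + 540 * t ^+ 8 + 1530 * t ^+ 7 + 2916 * t ^+ 6 + 3714 * t ^+ 5
    + 3486 * t ^+ 4 + 2278 * t ^+ 3 + 1144 * t ^+ 2 + 399 * t + 114)
   / ((5 * t ^+ 6 + 30 * t ^+ 5 + 45 * t ^+ 4 + 22 * t ^+ 3 - 13 * t ^+ 2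
       - 16 * t - 9) * r)).

End Solution43.

(* Main.v *)
Require Import Defs.
From Stdlib Require Import BinInt.
From mathcomp Require Import all_boot all_order all_algebra.
From mathcomp Require Import complex.
From mathcomp Require Import all_classical all_reals all_analysis.
From mathcomp Require Import ssrZ zify ring.

Set Implicit Arguments.
Unset Strict Implicit.
Unset Printing Implicit Defensive.

Import Order.TTheory GRing.Theory Num.Theory.
Import numFieldNormedType.Exports.
Local Open Scope classical_set_scope.
Local Open Scope ring_scope.

(** Put X = T - 1/2.  Since T - 1/2 and y - 1/2 are rational functions of t
    divided by r, and the square of r is a polynomial in t, both S = X^2 and
    G = (y - 1/2) / X are rational functions of t alone.  So r can be forgotten:
    near a generic point, t is the value at (x - 1/2)^2 of a local inverse g of S,
    and the solution is Y(x) = 1/2 + (x - 1/2) G(g((x - 1/2)^2)).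

    The local inverse exists over every algebraically closed field with a norm
    ([quotient_local_inverse]).  Openness of S replaces a fixed point argument: if
    |p(t)| is small compared with |p'(t)|, then p has a root near t, because
    p'/p is the sum of the 1/(t - z) over the roots z ([root_within]); this is
    applied to the numerator of S - s.

    By the chain rule dy/dT is a rational function of t, and the second derivative
    is X times another one.  As the parameters at 0 and 1 coincide, the equation
    is invariant under (x, y) -> (1 - x, 1 - y), hence both of its sides are odd in
    X; dividing by X leaves an identity between rational functions of t
    ([PVI_odd_part], [PVI_even_part]).  The functions S, S - 1/4 = T (T - 1),
    dS/dt, S G^2 - 1/4 = y (y - 1) and G - 1 = (y - T) / X split into few
    factors, which reduces the identity to integer polynomials of degree below 70,
    compared by computation ([PVI_z]).

    Algebraicity comes from a dimension count: S and S G^2 are rational functions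
    of one variable, hence algebraically dependent ([rational_functions_dependent]).
    The exceptional points of the curve lie over the roots of one polynomial in t,
    namely [branch], so they are finite in number. *)

(** * Derivatives of polynomials and quotients over a number field *)

Section PolynomialCalculus.
Variable K : numFieldType.
Implicit Types (p q : {poly K}) (f g : K -> K) (x : K).

(** Caratheodory's form of differentiability: it turns a factorization of the
    increments of a function directly into a derivative. *)
Lemma is_derive_slope f s x :
  (\forall z \near x, f z - f x = s z * (z - x)) -> {for x, continuous s} ->
  is_derive x 1 f (s x).
Proof.
move=> fs sx.
have fs' : \forall y \near 0, f (y + x) - f x = s (y + x) * y.
  move: fs; rewrite (near_shift 0 x) subr0; apply: filterS => y /=.
  by rewrite addrK.
suff H : h^-1 *: ((f \o shift x) h%:A - f x) @[h --> 0^'] --> s x.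
  have F1 : 'D_1 f x = s x by apply: cvg_lim.
  by rewrite -F1 in H *; constructor.
have /(cvg_trans _) : (s \o shift x) y @[y --> 0^'] --> s x.
  exact/continuous_withinNshiftx.
apply; apply: near_eq_cvg; near=> y.
have yx : f (y + x) - f x = s (y + x) * y by near: y; exact: cvg_within fs'.
have y0 : y != 0 by near: y; exact: nbhs_dnbhs_neq.
by rewrite /= [_%:A]mulr1 yx [RHS]mulrC mulfK.
Unshelve. all: by end_near. Qed.

Lemma is_derive_chain f g x (a b : K) :
  is_derive (g x) 1 f a -> is_derive x 1 g b ->
  is_derive x 1 (f \o g) (a * b).
Proof.
move=> [df <-] [dg <-]; have [/derivable1_diffP df' /derivable1_diffP dg'] := (df, dg).
apply: DeriveDef; first exact/derivable1_diffP/differentiable_comp.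
rewrite -!derive1E derive1E'; last exact/differentiable_comp.
rewrite diff_comp // !derive1E' //= -[X in 'd  _ _ X = _]mulr1.
by rewrite [LHS]linearZ mulrC.
Qed.

Lemma is_derive_affine_mul f x (c d df : K) : is_derive x 1 f df ->
  is_derive x 1 (fun z => d + (z - c) * f z) (f x + (x - c) * df).
Proof.
move=> Df; apply: is_derive_eq.
by rewrite add0r subr0 /GRing.scale /= mulr1 addrC.
Qed.

Lemma is_derive_horner p x : is_derive x 1 (horner p) p^`().[x].
Proof.
elim/poly_ind: p => [|p c IH].
  rewrite (_ : horner 0 = cst 0); last by apply/funext => y; rewrite horner0.
  by rewrite deriv0 horner0; exact: is_derive_cst.
rewrite (_ : horner _ = (horner p) * id + cst c); last first.
  by apply/funext => y; rewrite !hornerE.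
apply: is_derive_eq.
rewrite derivD derivM derivX derivC !hornerE /=.
by rewrite addrC [_%:A]mulr1 [_ *: _]mulrC.
Qed.

Lemma is_derive_quotient p q x : q.[x] != 0 ->
  is_derive x 1 (fun z => p.[z] / q.[z])
    ((p^`() * q - p * q^`()).[x] / q.[x] ^+ 2).
Proof.
move=> qx; have dp := is_derive_horner p x; have dq := is_derive_horner q x.
have dV : is_derive x 1 (fun z => q.[z]^-1) (- q.[x] ^- 2 *: q^`().[x]).
  case: dq => dq <-.
  by apply: DeriveDef; [exact: derivableV | exact: deriveV].
apply: is_derive_eq; rewrite !hornerE /=.
by rewrite /GRing.scale /=; field.
Qed.

Lemma horner_continuous p : continuous (horner p).
Proof.
move=> x; apply/differentiable_continuous/derivable1_diffP.
by case: (is_derive_horner p x).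
Qed.

Lemma open_nonroot p : open [set x | p.[x] != 0].
Proof.
rewrite (_ : mkset _ = horner p @^-1` [set y | y != 0]) //.
apply: open_comp; first by move=> x _; exact: horner_continuous.
rewrite (_ : mkset _ = ~` [set 0]); last by apply/seteqP; split=> y /eqP.
apply/closed_openC/accessible_closed_set1/hausdorff_accessible.
exact: norm_hausdorff.
Qed.

End PolynomialCalculus.

(** * A root near an almost-root *)

Section RootsNearby.
Variable C : numClosedFieldType.
Implicit Types (p : {poly C}) (x z e : C).

(** The logarithmic derivative of [p] at [x] is the sum of the [1 / (x - z)] over
    the roots [z], so it is at most [size rs / e] when all roots are at distance
    at least [e]; the inequality is multiplied out because [p.[x]] may vanish. *)
Lemma deriv_prod_far (rs : seq C) x e : 0 < e ->
  (forall z, z \in rs -> e <= `|x - z|) ->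
  let p := \prod_(z <- rs) ('X - z%:P) in
  e * `|p^`().[x]| <= (size rs)%:R * `|p.[x]|.
Proof.
move=> e0; elim: rs => [|z rs IH] far /=.
  by rewrite big_nil derivC horner0 normr0 mulr0 mul0r.
have xz : e <= `|x - z| by apply: far; rewrite mem_head.
have {}IH := IH (fun y yrs => far y (@mem_behead _ (z :: rs) y yrs)).
rewrite big_cons; set q := \prod_(_ <- _) _ in IH *.
rewrite derivM derivXsubC mul1r !hornerE normrM /=.
apply: le_trans (ler_wpM2l (ltW e0) (ler_normD _ _)) _.
have h1 : e * `|q.[x]| <= `|x - z| * `|q.[x]| by apply: ler_wpM2r.
have h2 : e * (`|x - z| * `|q^`().[x]|) <=
    (size rs)%:R * (`|x - z| * `|q.[x]|).
  by rewrite mulrCA [leRHS]mulrCA; apply: ler_wpM2l.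
by rewrite mulrDr normrM -natr1 mulrDl mul1r addrC lerD.
Qed.

(** Contrapositive of the previous bound.  The estimate does not involve the
    leading coefficient, so it is uniform over a pencil of polynomials in which
    the degree may drop. *)
Lemma root_within p x e : 0 < e ->
  (size p)%:R * `|p.[x]| < e * `|p^`().[x]| ->
  exists2 z, root p z & `|x - z| < e.
Proof.
move=> e0; have [->|p0] := eqVneq p 0.
  by rewrite deriv0 !horner0 normr0 !mulr0 ltxx.
have [rs prs] := closed_field_poly_normal p.
have [/hasP[z zrs xz] _|/hasPn far] := boolP (has (fun z => `|x - z| < e) rs).
  by exists z => //; rewrite prs rootZ ?lead_coef_eq0 // root_prod_XsubC.
have {}far z : z \in rs -> e <= `|x - z|.
  by move=> /far; rewrite real_ltNge ?negbK ?normr_real ?gtr0_real.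
have := deriv_prod_far e0 far.
rewrite /=; set q := \prod_(_ <- _) _ in prs * => far'.
have sp : (size rs <= size p)%N.
  by rewrite prs size_scale ?lead_coef_eq0 // /q size_prod_XsubC.
move: (size p) sp => n sp.
rewrite prs derivZ !hornerZ !normrM mulrCA [e * _]mulrCA.
rewrite ltr_pM2l ?normr_gt0 ?lead_coef_eq0 //.
move=> /lt_le_trans/(_ far').
by rewrite le_gtF // ler_wpM2r // ler_nat.
Qed.
End RootsNearby.

(** * Local inverses of rational functions *)

Section LocalInverse.
Variable C : numClosedFieldType.
Implicit Types (p q : {poly C}) (t : C).

Lemma divided_difference p : exists2 d : C * C -> C, continuous d &
  (forall t, d (t, t) = p^`().[t]) /\
  (forall a b, p.[a] - p.[b] = d (a, b) * (a - b)).
Proof.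
elim/poly_ind: p => [|p c [d dc [dd dp]]].
  exists (fun _ => 0); first exact: cst_continuous.
  by split=> [t|a b]; rewrite ?deriv0 !horner0 // subrr mul0r.
exists (fun u => d u * u.1 + p.[u.2]).
  move=> u; apply: cvgD.
    by apply: cvgM; [exact: dc | exact: cvg_fst].
  by apply: continuous_comp; [exact: cvg_snd | exact: horner_continuous].
split=> [t|a b]; first by rewrite dd derivD derivM derivX derivC !hornerE /=.
rewrite !hornerE /=.
have -> : p.[a] = d (a, b) * (a - b) + p.[b] by rewrite -dp subrK.
by ring.
Qed.

Definition wronskian p q : {poly C} := p^`() * q - p * q^`().

Lemma quotient_divided_difference p q : exists2 d : C * C -> C, continuous d &
  (forall t, d (t, t) = (wronskian p q).[t]) /\
  (forall a b, p.[a] * q.[b] - p.[b] * q.[a] = d (a, b) * (a - b)).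
Proof.
have [dp dpc [dpE pE]] := divided_difference p.
have [dq dqc [dqE qE]] := divided_difference q.
exists (fun u => dp u * q.[u.2] - p.[u.2] * dq u).
  have c2 (r : {poly C}) (u : C * C) : {for u, continuous (fun v => r.[v.2])}.
    by apply: continuous_comp; [exact: cvg_snd | exact: horner_continuous].
  by move=> u; apply: cvgB; apply: cvgM => //; (exact: c2 || exact: dpc || exact: dqc).
split=> [t|a b]; first by rewrite dpE dqE /wronskian !hornerE.
rewrite /= mulrBl mulrAC -pE -mulrA -qE; ring.
Qed.

(** A rational function is open where its derivative does not vanish: solutions
    of [p / q = s] near [t] are roots of [p - s q], whose value at [t] is small
    for [s] close to [p.[t] / q.[t]] while its derivative at [t] stays away from
    zero, so there is a root nearby. *)
Lemma quotient_open_map p q t (A : set C) :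
  q.[t] != 0 -> (wronskian p q).[t] != 0 -> nbhs t A ->
  \forall s \near p.[t] / q.[t], exists2 z, A z & s = p.[z] / q.[z].
Proof.
move=> qt wt At.
have /nbhs_ballP[e /= e0 eA] : nbhs t (A `&` [set z | q.[z] != 0]).
  apply: filterI => //; apply: open_nbhs_nbhs; split=> //; exact: open_nonroot.
set s0 := p.[t] / q.[t].
pose v s := p.[t] - s * q.[t]; pose v' s := p^`().[t] - s * q^`().[t].
have v0 : v s0 = 0 by rewrite /v /s0 divfK // subrr.
have v'0 : v' s0 != 0.
  rewrite (_ : v' s0 = (wronskian p q).[t] / q.[t]) ?mulf_neq0 ?invr_eq0 //.
  by rewrite /v' /s0 /wronskian !hornerE /=; field.
have lin (a b : C) : {for s0, continuous (fun s : C => a - s * b)}.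
  have -> : (fun s : C => a - s * b) = horner (a%:P - b *: 'X).
    by apply/funext => s; rewrite !hornerE mulrC.
  exact: horner_continuous.
pose n := maxn (size p) (size q).
pose c := `|v' s0| / 2.
have c0 : 0 < c by apply: divr_gt0 => //; rewrite normr_gt0.
have cs : \forall s \near s0, `|v s| < e * c / n.+1%:R.
  have /cvgrPdist_lt/(_ (e * c / n.+1%:R)) : v s @[s --> s0] --> v s0 by exact: lin.
  rewrite v0 => /(_ (divr_gt0 (mulr_gt0 e0 c0) (ltr0Sn _ _))).
  by apply: filterS => s; rewrite sub0r normrN.
have cs' : \forall s \near s0, c < `|v' s|.
  have /cvgrPdist_lt/(_ _ c0) : v' s @[s --> s0] --> v' s0 by exact: lin.
  apply: filterS => s sc.
  have : `|v' s0| - `|v' s| < c by apply: le_lt_trans sc; exact: lerB_dist.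
  by rewrite ltrBlDr {1}[`|v' s0|]splitr -/c ltrD2l.
near=> s.
have [z] : exists2 z, root (p - s *: q) z & `|t - z| < e.
  apply: root_within => //.
  have -> : (p - s *: q).[t] = v s by rewrite !hornerE.
  have -> : (p - s *: q)^`().[t] = v' s by rewrite derivB derivZ !hornerE.
  have vs : `|v s| < e * c / n.+1%:R by near: s.
  have v's : c < `|v' s| by near: s.
  apply: (@lt_trans _ _ (e * c)); last by rewrite ltr_pM2l.
  apply: (@le_lt_trans _ _ (n.+1%:R * `|v s|)); last first.
    by rewrite mulrC -ltr_pdivlMr ?ltr0Sn.
  apply: ler_wpM2r => //; rewrite ler_nat.
  apply: leq_trans (leqnSn n); apply: leq_trans (size_polyD _ _) _.
  rewrite size_polyN geq_max leq_maxl /= (leq_trans (size_scale_leq _ _)) //.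
  exact: leq_maxr.
rewrite /root !hornerE subr_eq0 => /eqP pz tz.
have [Az qz] := eA z tz; exists z => //.
by rewrite pz mulfK.
Unshelve. all: by end_near. Qed.

(** The holomorphic inverse function theorem for [p / q], without completeness:
    injectivity near [t0] holds because the divided difference tends to the
    nonzero Wronskian, surjectivity onto an open set is the open mapping
    property, and the slopes of the inverse are the inverses of the divided
    differences.  The polynomial [r] collects everything that should not vanish
    on the neighbourhood [U]. *)
Lemma quotient_local_inverse p q r t0 :
  (forall t, r.[t] != 0 -> q.[t] != 0 /\ (wronskian p q).[t] != 0) ->
  r.[t0] != 0 ->
  exists (U : set C) (g : C -> C),
  [/\ open U /\ U t0,
      forall t, U t -> r.[t] != 0,
      open [set p.[t] / q.[t] | t in U],
      forall t, U t -> g (p.[t] / q.[t]) = t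
    & forall t, U t -> is_derive (p.[t] / q.[t]) 1 g
                         (q.[t] ^+ 2 / (wronskian p q).[t])].
Proof.
move=> rqw rt0; have [d dc [dw dE]] := quotient_divided_difference p q.
have [U [oU Ut0 Ur Ud]] : exists U : set C,
    [/\ open U, U t0, forall t, U t -> r.[t] != 0 &
        forall a b, U a -> U b -> d (a, b) != 0].
  have : \forall u \near (t0, t0), d u != 0.
    apply: (dc (t0, t0) [set x | x != 0]).
    apply: open_nbhs_nbhs; split; last by rewrite dw; case: (rqw t0 rt0).
    rewrite (_ : mkset _ = [set x | ('X : {poly C}).[x] != 0]); first exact: open_nonroot.
    by apply/seteqP; split=> x /=; rewrite hornerX.
  case=> -[A B] /= [At0 Bt0] AB.
  exists (A `&` B `&` [set t | r.[t] != 0])°.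
  split; [exact: open_interior | | |].
  - apply: filterI; first exact: filterI.
    by apply: open_nbhs_nbhs; split=> //; exact: open_nonroot.
  - by move=> t /interior_subset[].
  - move=> a b /interior_subset[[Aa _] _] /interior_subset[[_ Bb] _].
    exact: (AB (a, b)).
pose S t := p.[t] / q.[t].
have qU t : U t -> q.[t] != 0 by move=> /Ur /rqw[].
have wU t : U t -> (wronskian p q).[t] != 0 by move=> /Ur /rqw[].
have SB a b : U a -> U b -> S a - S b = d (a, b) * (a - b) / (q.[a] * q.[b]).
  move=> Ua Ub; rewrite -dE /S; field; by rewrite !qU.
pose g s := xget t0 [set t | U t /\ S t = s].
have gS t : U t -> g (S t) = t.
  move=> Ut; rewrite /g; case: xgetP => [z _ [Uz Szt] | /(_ t)[]//].
  apply/eqP; rewrite -subr_eq0; have := SB _ _ Uz Ut.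
  move/eqP; rewrite Szt subrr eq_sym !mulf_eq0 (negPf (Ud _ _ Uz Ut)) /=.
  by rewrite invr_eq0 mulf_eq0 (negPf (qU _ Uz)) (negPf (qU _ Ut)) !orbF.
have opn t A : U t -> nbhs t A -> \forall s \near S t, exists2 z, A z & s = S z.
  by move=> Ut; apply: quotient_open_map; [exact: qU | exact: wU].
have nU t : U t -> nbhs t U by move=> Ut; apply: open_nbhs_nbhs.
exists U, g; split=> //.
  rewrite openE => _ [t Ut <-]; rewrite /interior.
  by apply: filterS (opn t U Ut (nU t Ut)) => s [z Uz ->]; exists z.
move=> t Ut.
have gc : {for S t, continuous g}.
  move=> A; rewrite gS // => At.
  apply: filterS (opn _ _ Ut (filterI At (nU t Ut))) => s [z [Az Uz] ->].
  by rewrite /= gS.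
have -> : q.[t] ^+ 2 / (wronskian p q).[t] =
    q.[g (S t)] * q.[t] / d (g (S t), t) by rewrite gS // dw expr2.
apply: (is_derive_slope (s := fun s => q.[g s] * q.[t] / d (g s, t))).
  apply: filterS (opn _ _ Ut (nU t Ut)) => s [z Uz ->].
  rewrite !gS // SB //; field.
  by rewrite Ud // !qU.
apply: continuousM.
  apply: continuousM; last exact: cst_continuous.
  by apply: continuous_comp; [exact: gc | exact: horner_continuous].
apply: continuousV; first by rewrite gS // Ud.
apply: (@continuous_comp _ _ _ (fun s => (g s, t)) d); last exact: dc.
exact: (cvg_pair gc (cvg_cst t)).
Qed.

End LocalInverse.

(** * Integer polynomial identities by computation *)

(** Polynomials with integer coefficients are kept as expression trees: the
    constructors are rigid, so that rewriting never unfolds the arithmetic, and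
    an identity is decided by computing lists of binary integers. *)
Inductive zexpr : Type :=
| ZLit of seq Z
| ZAdd of zexpr & zexpr
| ZScale of Z & zexpr
| ZMul of zexpr & zexpr
| ZExp of zexpr & nat
| ZDeriv of zexpr.

Declare Scope zexpr_scope.
Delimit Scope zexpr_scope with zexpr.
Bind Scope zexpr_scope with zexpr.
Notation "p + q" := (ZAdd p q) : zexpr_scope.
Notation "c *: p" := (ZScale c p) : zexpr_scope.
Notation "p - q" := (ZAdd p (ZScale (-1) q)) : zexpr_scope.
Notation "p * q" := (ZMul p q) : zexpr_scope.
Notation "p ^ n" := (ZExp p n) : zexpr_scope.

Fixpoint coef_add (p q : seq Z) : seq Z :=
  match p, q with
  | [::], _ => q
  | _, [::] => p
  | x :: p', y :: q' => Z.add x y :: coef_add p' q'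
  end.

Fixpoint coef_mul (p q : seq Z) : seq Z :=
  if p is x :: p' then coef_add (map (Z.mul x) q) (Z0 :: coef_mul p' q)
  else [::].

Fixpoint coef_deriv (p : seq Z) : seq Z :=
  if p is x :: p' then coef_add p' (Z0 :: coef_deriv p') else [::].

Fixpoint coefs (e : zexpr) : seq Z :=
  match e with
  | ZLit s => s
  | ZAdd p q => coef_add (coefs p) (coefs q)
  | ZScale c p => map (Z.mul c) (coefs p)
  | ZMul p q => coef_mul (coefs p) (coefs q)
  | ZExp p n => iter n (coef_mul (coefs p)) [:: Z.one]
  | ZDeriv p => coef_deriv (coefs p)
  end.

(** The difference is compared with zero because [coefs] leaves trailing zeros. *)
Definition zeq (p q : zexpr) : bool := all (Z.eqb Z0) (coefs (p - q)).

Section IntegerPolynomials.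
Variable K : numFieldType.

Definition zK (c : Z) : K := (int_of_Z c)%:~R.

Lemma zKD c d : zK (Z.add c d) = zK c + zK d.
Proof. by rewrite -[Z.add c d]/(c + d) /zK !rmorphD. Qed.

Lemma zKM c d : zK (Z.mul c d) = zK c * zK d.
Proof. by rewrite -[Z.mul c d]/(c * d) /zK !rmorphM. Qed.

Definition lit (s : seq Z) : {poly K} := Poly (map zK s).

Fixpoint zpoly (e : zexpr) : {poly K} :=
  match e with
  | ZLit s => lit s
  | ZAdd p q => zpoly p + zpoly q
  | ZScale c p => zK c *: zpoly p
  | ZMul p q => zpoly p * zpoly q
  | ZExp p n => zpoly p ^+ n
  | ZDeriv p => (zpoly p)^`()
  end.

Lemma litS c s : lit (c :: s) = lit s * 'X + (zK c)%:P.
Proof. by rewrite /lit /= cons_poly_def. Qed.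

Lemma litD p q : lit (coef_add p q) = lit p + lit q.
Proof.
elim: p q => [|c p IH] [|d q]; rewrite ?add0r ?addr0 //.
by rewrite /= !litS IH zKD polyCD; ring.
Qed.

Lemma litZ c p : lit (map (Z.mul c) p) = zK c *: lit p.
Proof.
elim: p => [|d p IH]; first by rewrite /lit scaler0.
by rewrite /= !litS IH zKM polyCM -!mul_polyC; ring.
Qed.

Lemma litM p q : lit (coef_mul p q) = lit p * lit q.
Proof.
elim: p => [|c p IH]; first by rewrite /lit mul0r.
by rewrite /= litD litZ !litS IH -mul_polyC polyC0; ring.
Qed.

Lemma lit_deriv p : lit (coef_deriv p) = (lit p)^`().
Proof.
elim: p => [|c p IH]; first by rewrite /lit deriv0.
by rewrite /= litD !litS IH derivD derivM derivX derivC polyC0; ring.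
Qed.

Lemma zpolyE e : zpoly e = lit (coefs e).
Proof.
elim: e => /= [s|p -> q ->|c p ->|p -> q ->|p -> n|p ->] //.
- by rewrite litD.
- by rewrite litZ.
- by rewrite litM.
- elim: n => [|n IH]; last by rewrite exprS IH -litM.
  by rewrite expr0 litS /lit mul0r add0r.
- by rewrite lit_deriv.
Qed.

Lemma zeqP p q : zeq p q -> zpoly p = zpoly q.
Proof.
move=> pq; apply/eqP; rewrite -subr_eq0; apply/eqP.
transitivity (zpoly (p - q)); first by rewrite /= /zK /= scaleN1r.
rewrite zpolyE; move: pq; rewrite /zeq.
elim: (coefs _) => [|c r IH] //= /andP[c0 /IH r0].
have <- : Z0 = c by case: c c0.
by rewrite litS r0 mul0r add0r.
Qed.

Definition zval (t : K) (e : zexpr) : K := (zpoly e).[t].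

Lemma zvalD t p q : zval t (p + q) = zval t p + zval t q.
Proof. exact: hornerD. Qed.

Lemma zvalZ t c p : zval t (c *: p) = zK c * zval t p.
Proof. exact: hornerZ. Qed.

Lemma zvalM t p q : zval t (p * q) = zval t p * zval t q.
Proof. exact: hornerM. Qed.

Lemma zvalX t p n : zval t (p ^ n) = zval t p ^+ n.
Proof. exact: horner_exp. Qed.

Definition zvalE := (zvalD, zvalZ, zvalM, zvalX).

Lemma zval_lit t s : zval t (ZLit s) = horner_rec (map zK s) t.
Proof. exact: horner_Poly. Qed.

Lemma zvalP t p q : zeq p q -> zval t p = zval t q.
Proof. by rewrite /zval => /zeqP->. Qed.

End IntegerPolynomials.

(** Turns the images of integer literals into numerals, which the tactics [ring]
    and [field] understand. *)
Ltac zK_literals := repeat match goal with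
  | |- context [@zK ?K (Zpos ?p)] =>
      let n := eval vm_compute in (Pos.to_nat p) in
      change (@zK K (Zpos p)) with (n%:R : K)
  | |- context [@zK ?K (Zneg ?p)] =>
      let n := eval vm_compute in (Pos.to_nat p) in
      change (@zK K (Zneg p)) with (- n%:R : K)
  end.


(** * The solution in the parameter t *)

(** The coprime integer factors, coefficients in increasing degree, of the
    numerators and denominators of [S], [G], [T (T - 1)], [y (y - 1)], [G - 1]
    and [dy/dT]: [fB = t + 7], [fA = t + 2], [fM = 3 t + 1] and so on.  The
    numerators of [T - 1/2] and [y - 1/2] are [numT] and [(t + 7) numy]. *)
Section Data.
Local Open Scope Z_scope.
Definition fB : zexpr := ZLit [:: 7; 1].
Definition fA : zexpr := ZLit [:: 2; 1].
Definition fM : zexpr := ZLit [:: 1; 3].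
Definition fH : zexpr := ZLit [:: 2; 3; 3].
Definition fI : zexpr := ZLit [:: 1; 0; 1].
Definition fK : zexpr := ZLit [:: 2; 2; 3].
Definition fJ : zexpr := ZLit [:: 3; 3; 2].
Definition fG : zexpr := ZLit [:: 46; 140; 195; 165; 65; 13].
Definition fE : zexpr := ZLit [:: -9; -16; -13; 22; 45; 30; 5].
Definition fF : zexpr := ZLit [:: 102; 342; 770; 1252; 1571; 1458; 960; 468; 117].
Definition numy : zexpr := ZLit
  [:: 114; 399; 1144; 2278; 3486; 3714; 2916; 1530; 540; 135].
Definition numT : zexpr := ZLit
  [:: -216; -720; -1440; -1340; -5; 1926; 2745; 2160; 945; 270; 27].
Definition fD : zexpr := ZLit
  [:: 1140; 6576; 21506; 48879; 85285; 120702; 143830; 148869; 134885; 105687;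
      68701; 35216; 13198; 3159; 351].
End Data.

(** [S = (T - 1/2)^2]; the polynomial [3 (t + 2) (t + 7) (3 t^2 + 3 t + 2)]
    replaces the square of [r]. *)
Definition numS : zexpr := numT ^ 2.
Definition denS0 : zexpr := fB * fA ^ 5 * fH ^ 3 * fI ^ 4.
Definition denS : zexpr := 108 *: denS0.

(** [G = (y - 1/2) / (T - 1/2)], from which [r] cancels. *)
Definition numG : zexpr := fB * fA ^ 2 * fH * fI * numy.
Definition denG : zexpr := 3 *: (fE * numT).

(** The derivative of [y] with respect to [T], also free of [r]. *)
Definition numdy : zexpr := -1 *: (fB * fA ^ 2 * fH * fI * fD).
Definition dendy : zexpr := 12 *: (fM * fK * fJ ^ 2 * fE ^ 2).

Definition zwronskian p q : zexpr := ZDeriv p * q - p * ZDeriv q.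

Lemma wronskian_zpoly (C : numClosedFieldType) p q :
  wronskian (zpoly C p) (zpoly C q) = zpoly C (zwronskian p q).
Proof. by rewrite /= scaleN1r. Qed.

(** [S - 1/4 = T (T - 1)] is, up to a constant, the quotient of
    [fM ^ 5 * fK ^ 2 * fJ ^ 3] by [denS0]. *)
Lemma T_branch_z :
  zeq (numT ^ 2 + 16 *: (fM ^ 5 * fK ^ 2 * fJ ^ 3)) (27 *: denS0).
Proof. by vm_compute. Qed.

(** [T] ramifies only over 0, 1 and infinity, so [dS/dt] vanishes only where [S]
    or [S - 1/4] does. *)
Lemma wronskian_S_z :
  zeq (zwronskian numS denS)
      (108 *: (160 *: (numT * fM ^ 4 * fK * fJ ^ 2 * fA ^ 4 * fH ^ 2 * fI ^ 3))).
Proof. by vm_compute. Qed.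

(** Factorization of [S G^2 - 1/4 = y (y - 1)]. *)
Lemma y_branch_z :
  zeq (fB * numy ^ 2)
      (243 *: (fA * fH * fI ^ 2 * fE ^ 2) + 20 *: (fM ^ 4 * fK * fJ * fF)).
Proof. by vm_compute. Qed.

(** Factorization of [G - 1 = (y - T) / (T - 1/2)]. *)
Lemma y_sub_T_z : zeq (numG - denG) (2 *: (fM ^ 4 * fK * fJ * fG)).
Proof. by vm_compute. Qed.

(** [dy/dT = G + S (dG/dt) (2 dt/dS)], cleared of denominators: differentiate
    [y = 1/2 + (T - 1/2) G(t)] with [dt/dT = 2 (T - 1/2) dt/dS]. *)
Lemma dy_z :
  zeq ((80 *: (numG * denG * fM ^ 4 * fK * fJ ^ 2)
        + zwronskian numG denG * numT * fB * fA * fH * fI) * dendy)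
      (80 *: (numdy * fM ^ 4 * fK * fJ ^ 2 * denG ^ 2)).
Proof. by vm_compute. Qed.

(** The Painleve equation itself.  In the notation of [PVI_even_part] it is the
    conclusion of that lemma multiplied by
    [320/3 N m^10 k^4 j^6 e^4 f g / (b^2 a^6 h^4 i^5)]; the first two terms on the
    right come from the terms in [dy^2] and [dy], the last three from the one with
    the parameters. *)
Lemma PVI_z :
  zeq (zwronskian numdy dendy * fM ^ 4 * fK * fG * fF) (6 *:
    (2 *: (fB * fA * (numy * fG + 5 *: (fA ^ 2 * fH * fI * fF)) * fD ^ 2
           * fM ^ 4 * fK * fJ * fE)
     + 20 *: (fA * (12 *: (fE * fM * fK * fJ ^ 2) - numT * fG) * fD
              * fM ^ 4 * fK * fJ * fE ^ 2 * fF)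
     + 2 *: (fA ^ 3 * fH * fI * fF ^ 2 * fG ^ 2 * fM ^ 8 * fK ^ 2 * fJ ^ 2 * fE)
     - 3 *: (fG ^ 2 * fA ^ 2 * fH * fI ^ 2 * fE ^ 3
             * (10 *: (fM ^ 4 * fK * fJ * fF * fA ^ 2 * fH * fI)
                + 243 *: (fA ^ 3 * fH ^ 2 * fI ^ 3 * fE ^ 2)
                - 3 *: (numT * numy * fE)))
     - 150 *: (fA ^ 3 * fH * fI * fF ^ 2 * fM ^ 5 * fK ^ 2 * fJ ^ 3 * fE ^ 3))).
Proof. by vm_compute. Qed.

(** The equation is invariant under [(x, y) -> (1 - x, 1 - y)], because the
    parameters at 0 and 1 agree.  Hence with [x = 1/2 + X] and [y = 1/2 + X G] both
    sides are odd in [X], and after division by [X] only [S = X^2] remains. *)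
Lemma PVI_odd_part (K : numFieldType) (X S G k l : K) :
  X ^+ 2 = S -> S != 0 -> S - 1 / 4 != 0 -> S * G ^+ 2 - 1 / 4 != 0 ->
  G - 1 != 0 ->
  l = 1 / 2 * (2 * G / (S * G ^+ 2 - 1 / 4) + 1 / (S * (G - 1))) * k ^+ 2
      - (2 / (S - 1 / 4) + 1 / (S * (G - 1))) * k
      + (S * G ^+ 2 - 1 / 4) * (G - 1) / (S - 1 / 4) ^+ 2 *
        (9 / 50 - 1 / 18 * ((S * G ^+ 2 - 2 * S * G + 1 / 4)
                            / (S * G ^+ 2 - 1 / 4) ^+ 2)
         + 3 / 8 * ((S - 1 / 4) / (S * (G - 1) ^+ 2))) ->
  let x := 1 / 2 + X in let y := 1 / 2 + X * G in
  [/\ x != 0 /\ x != 1, [/\ y != 0, y != 1 & y != x] &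
  X * l =
    1 / 2 * (1 / y + 1 / (y - 1) + 1 / (y - x)) * k ^+ 2
    - (1 / x + 1 / (x - 1) + 1 / (y - x)) * k
    + y * (y - 1) * (y - x) / (x ^+ 2 * (x - 1) ^+ 2) *
      ((2 / 5 - 1) ^+ 2 / 2 - (1 / 3) ^+ 2 / 2 * (x / y ^+ 2)
       + (1 / 3) ^+ 2 / 2 * ((x - 1) / (y - 1) ^+ 2)
       + (1 - (1 / 2) ^+ 2) / 2 * (x * (x - 1) / (y - x) ^+ 2))].
Proof.
move=> XS S0 e0 c0 G1 -> x y.
have X0 : X != 0 by move: S0; rewrite -XS expf_eq0.
have xx : x * (x - 1) = S - 1 / 4 by rewrite -XS /x; field.
have yy : y * (y - 1) = S * G ^+ 2 - 1 / 4 by rewrite -XS /y; field.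
have yx : y - x = X * (G - 1) by rewrite /x /y; ring.
have [x0 x1] : x != 0 /\ x - 1 != 0.
  by apply/andP; rewrite -negb_or -mulf_eq0 xx.
have [y0 y1] : y != 0 /\ y - 1 != 0.
  by apply/andP; rewrite -negb_or -mulf_eq0 yy.
have yx0 : y - x != 0 by rewrite yx mulf_neq0.
split; [by rewrite -(subr_eq0 x 1) | by rewrite -(subr_eq0 y 1) -(subr_eq0 y x) | ].
rewrite -XS /y /x in x0 x1 y0 y1 yx0 e0 c0 *.
(* [field] clears the halves, so its side conditions are these terms doubled or
   quadrupled. *)
have scaled (n : nat) (z w : K) : z != 0 -> w = n.+1%:R * z -> w != 0.
  by move=> z0 ->; rewrite mulf_neq0 // pnatr_eq0.
field; do !(apply/andP; split=> //).
- by apply: (scaled 1 _ _ yx0); field.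
- by apply: (scaled 1 _ _ y1); field.
- by apply: (scaled 1 _ _ y0); field.
- by apply: (scaled 1 _ _ x1); field.
- by apply: (scaled 1 _ _ x0); field.
- by apply: (scaled 3 _ _ c0); field.
- by apply: (scaled 3 _ _ e0); field.
Qed.

(** Here the letters stand for the values of the factors at [t], [w] for the
    Wronskian of [numdy] and [dendy], and [27 / 20 * _] in [ddy] for
    [2 dt/dS].  Once [S - 1/4], [S G^2 - 1/4] and [G - 1] are factored, all
    denominators are monomials in the letters. *)
Lemma PVI_even_part (K : numFieldType) (b a m h i k j g e f M N p w : K) :
  let q := b * a ^+ 5 * h ^+ 3 * i ^+ 4 in
  let S := N ^+ 2 / (108 * q) in
  let G := b * a ^+ 2 * h * i * M / (3 * (e * N)) in
  let dy := - (b * a ^+ 2 * h * i * p) / (12 * (m * k * j ^+ 2 * e ^+ 2)) in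
  let ddy := w / (12 * (m * k * j ^+ 2 * e ^+ 2)) ^+ 2
    * (27 / 20 * b ^+ 2 * a ^+ 6 * h ^+ 4 * i ^+ 5 / (N * m ^+ 4 * k * j ^+ 2)) in
  [&& b != 0, a != 0, m != 0, h != 0, i != 0, k != 0, j != 0, g != 0, e != 0,
      f != 0 & N != 0] ->
  N ^+ 2 + 16 * (m ^+ 5 * k ^+ 2 * j ^+ 3) = 27 * q ->
  b * M ^+ 2 = 243 * (a * h * i ^+ 2 * e ^+ 2) + 20 * (m ^+ 4 * k * j * f) ->
  b * a ^+ 2 * h * i * M - 3 * (e * N) = 2 * (m ^+ 4 * k * j * g) ->
  w * m ^+ 4 * k * g * f = 6 *
    (2 * (b * a * (M * g + 5 * (a ^+ 2 * h * i * f)) * p ^+ 2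
          * m ^+ 4 * k * j * e)
     + 20 * (a * (12 * (e * m * k * j ^+ 2) - N * g) * p
             * m ^+ 4 * k * j * e ^+ 2 * f)
     + 2 * (a ^+ 3 * h * i * f ^+ 2 * g ^+ 2 * m ^+ 8 * k ^+ 2 * j ^+ 2 * e)
     - 3 * (g ^+ 2 * a ^+ 2 * h * i ^+ 2 * e ^+ 3
            * (10 * (m ^+ 4 * k * j * f * a ^+ 2 * h * i)
               + 243 * (a ^+ 3 * h ^+ 2 * i ^+ 3 * e ^+ 2) - 3 * (N * M * e)))
     - 150 * (a ^+ 3 * h * i * f ^+ 2 * m ^+ 5 * k ^+ 2 * j ^+ 3 * e ^+ 3)) ->
  [/\ S != 0, S - 1 / 4 != 0, S * G ^+ 2 - 1 / 4 != 0, G - 1 != 0 &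
   ddy = 1 / 2 * (2 * G / (S * G ^+ 2 - 1 / 4) + 1 / (S * (G - 1))) * dy ^+ 2
      - (2 / (S - 1 / 4) + 1 / (S * (G - 1))) * dy
      + (S * G ^+ 2 - 1 / 4) * (G - 1) / (S - 1 / 4) ^+ 2 *
        (9 / 50 - 1 / 18 * ((S * G ^+ 2 - 2 * S * G + 1 / 4)
                            / (S * G ^+ 2 - 1 / 4) ^+ 2)
         + 3 / 8 * ((S - 1 / 4) / (S * (G - 1) ^+ 2)))].
Proof.
move=> q S G dy ddy.
case/and5P=> b0 a0 m0 h0 /and5P[i0 k0 j0 g0 /and3P[e0 f0 N0]] TB yB yT eqn.
have ES : S - 1 / 4 = - 4 / 27 * (m ^+ 5 * k ^+ 2 * j ^+ 3) / q.
  transitivity ((N ^+ 2 - 27 * q) / (108 * q)).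
    by rewrite /S /q; field; rewrite a0 b0 h0 i0.
  by rewrite -TB /q; field; rewrite a0 b0 h0 i0.
have EU : S * G ^+ 2 - 1 / 4 =
    5 / 243 * (m ^+ 4 * k * j * f) / (a * h * i ^+ 2 * e ^+ 2).
  transitivity ((b * M ^+ 2 - 243 * (a * h * i ^+ 2 * e ^+ 2))
                / (972 * (a * h * i ^+ 2 * e ^+ 2))).
    by rewrite /S /G /q; field; rewrite N0 e0 a0 b0 h0 i0.
  by rewrite yB; field; rewrite e0 a0 h0 i0.
have EG : G - 1 = 2 / 3 * (m ^+ 4 * k * j * g) / (e * N).
  transitivity ((b * a ^+ 2 * h * i * M - 3 * (e * N)) / (3 * (e * N))).
    by rewrite /G; field; rewrite N0 e0.
  by rewrite yT; field; rewrite N0 e0.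
have S0 : S != 0 by rewrite /S /q !(mulf_neq0, invr_eq0, expf_neq0) ?pnatr_eq0.
have e1 : S - 1 / 4 != 0.
  rewrite ES /q.
  by rewrite !(mulf_neq0, invr_eq0, expf_neq0) ?oppr_eq0 ?pnatr_eq0.
have c1 : S * G ^+ 2 - 1 / 4 != 0.
  by rewrite EU !(mulf_neq0, invr_eq0, expf_neq0) ?pnatr_eq0.
have G1 : G - 1 != 0.
  by rewrite EG !(mulf_neq0, invr_eq0, expf_neq0) ?pnatr_eq0.
split=> //.
have -> : S * G ^+ 2 - 2 * S * G + 1 / 4 =
    (S * G ^+ 2 - 1 / 4) + 1 / 2 - 2 * S * G by field.
rewrite ES EU EG {e1 c1 G1 ES EU EG S0}.
rewrite /ddy; move: eqn; set rhs := 6 * _ => eqn.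
have -> : w = rhs / (m ^+ 4 * k * g * f).
  by rewrite -eqn; field; rewrite m0 k0 g0 f0.
rewrite /rhs /dy /S /G /q.
field.
by rewrite a0 b0 m0 h0 i0 k0 j0 g0 e0 f0 N0.
Qed.

(** Away from the zeros of this product the points of the curve are generic: [T]
    and [y] are finite, [T] is a local coordinate, and [T], [y] avoid the singular
    locus of the equation. *)
Definition branch : zexpr :=
  (fB * fA * fM * fH * fI * fK * fJ * fG * fE * fF * numT).

Section Values.
Variables (K : numFieldType) (t : K).
Hypothesis generic : zval t branch != 0.
Local Notation v := (zval t).

Lemma factors_neq0 :
  [&& v fB != 0, v fA != 0, v fM != 0, v fH != 0, v fI != 0, v fK != 0,
      v fJ != 0, v fG != 0, v fE != 0, v fF != 0 & v numT != 0].
Proof.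
move: generic; rewrite /branch !zvalE !mulf_eq0 !negb_or -!andbA.
by case/and5P=> -> -> -> -> /and5P[-> -> -> -> /andP[-> ->]].
Qed.

Lemma denS_neq0 : v denS != 0.
Proof.
move: factors_neq0; case/and5P=> b0 a0 m0 h0 /and5P[i0 k0 j0 g0 /and3P[e0 f0 N0]].
rewrite !zvalE; zK_literals.
by rewrite !(mulf_neq0, expf_neq0) ?pnatr_eq0.
Qed.

Lemma denG_neq0 : v denG != 0.
Proof.
move: factors_neq0; case/and5P=> b0 a0 m0 h0 /and5P[i0 k0 j0 g0 /and3P[e0 f0 N0]].
rewrite !zvalE; zK_literals.
by rewrite !(mulf_neq0, expf_neq0) ?pnatr_eq0.
Qed.

Lemma dendy_neq0 : v dendy != 0.
Proof.
move: factors_neq0; case/and5P=> b0 a0 m0 h0 /and5P[i0 k0 j0 g0 /and3P[e0 f0 N0]].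
rewrite !zvalE; zK_literals.
by rewrite !(mulf_neq0, expf_neq0) ?pnatr_eq0.
Qed.

Lemma wronskianS_neq0 : v (zwronskian numS denS) != 0.
Proof.
move: factors_neq0; case/and5P=> b0 a0 m0 h0 /and5P[i0 k0 j0 g0 /and3P[e0 f0 N0]].
rewrite (zvalP t wronskian_S_z) !zvalE; zK_literals.
by rewrite !(mulf_neq0, expf_neq0) ?pnatr_eq0.
Qed.

(** [dt/dS]. *)
Definition rate : K := v denS ^+ 2 / v (zwronskian numS denS).

Lemma rateE : 2 * rate = 27 / 20 * v fB ^+ 2 * v fA ^+ 6 * v fH ^+ 4 * v fI ^+ 5
  / (v numT * v fM ^+ 4 * v fK * v fJ ^+ 2).
Proof.
move: factors_neq0; case/and5P=> b0 a0 m0 h0 /and5P[i0 k0 j0 g0 /and3P[e0 f0 N0]].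
rewrite /rate (zvalP t wronskian_S_z) /denS /denS0 !zvalE; zK_literals; field.
by rewrite a0 h0 i0 m0 k0 j0 N0.
Qed.

Lemma dy_val :
  v numG / v denG + v numS / v denS
    * (v (zwronskian numG denG) / v denG ^+ 2 * (2 * rate)) = v numdy / v dendy.
Proof.
(* The difference of the two sides of the goal, times [D], is that of the identity. *)
have key (D l r x y : K) : D != 0 -> l = r -> (x - y) * D = l - r -> x = y.
  move=> D0 -> /eqP; rewrite subrr mulf_eq0 (negPf D0) orbF subr_eq0.
  by move/eqP.
move: factors_neq0; case/and5P=> b0 a0 m0 h0 /and5P[i0 k0 j0 g0 /and3P[e0 f0 N0]].
apply: (key (80 * (v fM ^+ 4 * v fK * v fJ ^+ 2) * v denG ^+ 2 * v dendy)
          _ _ _ _ _ (zvalP t dy_z)).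
  by rewrite !(mulf_neq0, expf_neq0) ?pnatr_eq0 ?denG_neq0 ?dendy_neq0.
rewrite rateE !zvalE; zK_literals; field.
by rewrite a0 b0 m0 h0 i0 k0 j0 e0 N0.
Qed.

(** For [X = T - 1/2], so that [rate * (2 * X)] is [dt/dT], [dy] and [ddy] are the
    first and second derivatives of [y] with respect to [T]. *)
Lemma PVI_generic (X : K) : X ^+ 2 = v numS / v denS ->
  let x := 1 / 2 + X in let y := 1 / 2 + X * (v numG / v denG) in
  let dy := v numdy / v dendy in
  let ddy := v (zwronskian numdy dendy) / v dendy ^+ 2 * (rate * (2 * X)) in
  [/\ x != 0 /\ x != 1, [/\ y != 0, y != 1 & y != x] &
  ddy =
    1 / 2 * (1 / y + 1 / (y - 1) + 1 / (y - x)) * dy ^+ 2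
    - (1 / x + 1 / (x - 1) + 1 / (y - x)) * dy
    + y * (y - 1) * (y - x) / (x ^+ 2 * (x - 1) ^+ 2) *
      ((2 / 5 - 1) ^+ 2 / 2 - (1 / 3) ^+ 2 / 2 * (x / y ^+ 2)
       + (1 / 3) ^+ 2 / 2 * ((x - 1) / (y - 1) ^+ 2)
       + (1 - (1 / 2) ^+ 2) / 2 * (x * (x - 1) / (y - x) ^+ 2))].
Proof.
move=> XS x y dy ddy.
have ddyE : ddy = X * (v (zwronskian numdy dendy) / v dendy ^+ 2 * (2 * rate)).
  by rewrite /ddy; ring.
have dyE : dy = - (v fB * v fA ^+ 2 * v fH * v fI * v fD)
    / (12 * (v fM * v fK * v fJ ^+ 2 * v fE ^+ 2)).
  by rewrite /dy !zvalE; zK_literals; rewrite mulN1r.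
have SE : v numS / v denS =
    v numT ^+ 2 / (108 * (v fB * v fA ^+ 5 * v fH ^+ 3 * v fI ^+ 4)).
  by rewrite !zvalE; zK_literals.
have GE : v numG / v denG =
    v fB * v fA ^+ 2 * v fH * v fI * v numy / (3 * (v fE * v numT)).
  by rewrite !zvalE; zK_literals.
have KE : v dendy = 12 * (v fM * v fK * v fJ ^+ 2 * v fE ^+ 2).
  by rewrite !zvalE; zK_literals.
have [||||] :=
   @PVI_even_part K (v fB) (v fA) (v fM) (v fH) (v fI) (v fK) (v fJ) (v fG)
    (v fE) (v fF) (v numy) (v numT) (v fD) (v (zwronskian numdy dendy)) factors_neq0.
- by have := zvalP t T_branch_z; rewrite !zvalE; zK_literals.
- by have := zvalP t y_branch_z; rewrite !zvalE; zK_literals.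
- by have := zvalP t y_sub_T_z; rewrite !zvalE; zK_literals; rewrite mulN1r.
- by have := zvalP t PVI_z; rewrite !zvalE; zK_literals; rewrite !mulN1r.
rewrite -dyE -SE -GE -KE -rateE => S0 e1 c1 G1 eqn.
by rewrite ddyE; exact: (PVI_odd_part XS S0 e1 c1 G1 eqn).
Qed.
End Values.

(** * The local solutions *)

Section LocalSolution.
Variable C : numClosedFieldType.
Implicit Types (t x : C).
Local Notation v := (@zval C).

Definition fS t : C := v t numS / v t denS.
Definition fracG t : C := v t numG / v t denG.
Definition fdy t : C := v t numdy / v t dendy.

(** With [g] a local inverse of [S], the solution is
    [Y x = 1/2 + (x - 1/2) G(g((x - 1/2)^2))].  Its domain is symmetric about 1/2
    and contains the values of [T] at the points over [U] for both choices of [r],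
    since they are exchanged by [x -> 1 - x]. *)
Lemma local_solution t0 : v t0 branch != 0 ->
  exists (U : set C) (Y : C -> C),
  [/\ open U /\ U t0,
      forall t, U t -> v t branch != 0,
      PVI_solution (1 / 3) (1 / 3) (1 / 2) (2 / 5)
        [set x | exists2 t, U t & (x - 1 / 2) ^+ 2 = fS t] Y
    & forall t x, U t -> (x - 1 / 2) ^+ 2 = fS t ->
        Y x = 1 / 2 + (x - 1 / 2) * fracG t].
Proof.
move=> gen0.
have [t gent|U [g [[oU Ut0] genU oV gS dg]]] :=
  @quotient_local_inverse C (zpoly C numS) (zpoly C denS) (zpoly C branch) t0 _ gen0.
  rewrite wronskian_zpoly; split; [exact: denS_neq0 | exact: wronskianS_neq0].
have {}genU t : U t -> v t branch != 0 by exact: genU.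
have {}gS t : U t -> g (fS t) = t by exact: gS.
have {}dg t : U t -> is_derive (fS t) 1 g (rate t).
  by move=> /dg; rewrite wronskian_zpoly.
pose W := [set x | exists2 t, U t & (x - 1 / 2) ^+ 2 = fS t].
pose T x := g ((x - 1 / 2) ^+ 2).
have WT x : W x -> U (T x) /\ (x - 1 / 2) ^+ 2 = fS (T x).
  by case=> t Ut xt; rewrite /T xt gS.
have oW : open W.
  have -> : W = horner (('X - (1 / 2)%:P) ^+ 2) @^-1` [set fS t | t in U].
    apply/seteqP; split=> [x [t Ut xt]|x [t Ut]].
      by exists t; rewrite // -xt !hornerE.
    by rewrite !hornerE => tx; exists t; rewrite // mul1r.
  by apply: open_comp => // x _; exact: horner_continuous.
have dsq x : is_derive x 1 (fun x => (x - 1 / 2) ^+ 2) (2 * (x - 1 / 2)).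
  have -> : (fun x : C => (x - 1 / 2) ^+ 2) = horner (('X - (1 / 2)%:P) ^+ 2).
    by apply/funext => z; rewrite !hornerE.
  apply: is_derive_eq (is_derive_horner _ x) _.
  by rewrite deriv_exp derivXsubC !hornerE /=; ring.
have dT x : W x -> is_derive x 1 T (rate (T x) * (2 * (x - 1 / 2))).
  move=> /WT[UT xT].
  have dgx : is_derive ((x - 1 / 2) ^+ 2) 1 g (rate (T x)).
    by rewrite xT; exact: dg.
  exact: (@is_derive_chain _ g (fun x : C => (x - 1 / 2) ^+ 2) x _ _ dgx (dsq x)).
have dquo p q x : W x -> v (T x) q != 0 ->
    is_derive x 1 (fun x => v (T x) p / v (T x) q)
      (v (T x) (zwronskian p q) / v (T x) q ^+ 2 * (rate (T x) * (2 * (x - 1 / 2)))).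
  move=> Wx q0.
  have := is_derive_quotient (zpoly C p) (q := zpoly C q) (x := T x) q0.
  rewrite -/(wronskian _ _) wronskian_zpoly => dpq.
  exact: (@is_derive_chain _ (fun t : C => v t p / v t q) T x _ _ dpq (dT x Wx)).
pose Y x := 1 / 2 + (x - 1 / 2) * fracG (T x).
have dY x : W x -> is_derive x 1 Y (fdy (T x)).
  move=> Wx; have [UT xT] := WT x Wx.
  have dG := dquo numG denG x Wx (denG_neq0 (genU _ UT)).
  rewrite /fdy -(dy_val (genU _ UT)) -/(fS _) -xT.
  have := is_derive_affine_mul (1 / 2) (1 / 2) dG.
  congr is_derive; rewrite /fracG; ring.
have dY1 x : W x -> (Y^`())%classic x = fdy (T x).
  by move=> /dY dYx; rewrite derive1E (@derive_val _ _ _ _ _ _ _ dYx).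
have dY2 x : W x -> is_derive x 1 (Y^`())%classic
    (v (T x) (zwronskian numdy dendy) / v (T x) dendy ^+ 2
     * (rate (T x) * (2 * (x - 1 / 2)))).
  move=> Wx; have [UT _] := WT x Wx.
  have dK := dquo numdy dendy x Wx (dendy_neq0 (genU _ UT)).
  apply: near_eq_is_derive dK.
  have : nbhs x W by exact: open_nbhs_nbhs.
  by apply: filterS => z Wz; rewrite dY1.
exists U, Y; split=> //; last by move=> t x Ut xt; rewrite /Y /T xt gS.
split=> // x Wx; have [UT xT] := WT x Wx.
have [[x0 x1] yneq eqn] := PVI_generic (genU _ UT) xT.
have xE : 1 / 2 + (x - 1 / 2) = x by ring.
have YE : 1 / 2 + (x - 1 / 2) * fracG (T x) = Y x by [].
rewrite -/(fracG _) -/(fdy _) YE xE in x0 x1 yneq eqn.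
split=> //.
- by split; [case: (dY x Wx) | case: (dY2 x Wx)].
- rewrite /PVI_eq derive1nS derive1n1.
  rewrite dY1 // derive1E (@derive_val _ _ _ _ _ _ _ (dY2 x Wx)).
  by rewrite eqn mulNr.
Qed.

End LocalSolution.

(** * Algebraic dependence of rational functions *)

Section AlgebraicDependence.
Variable K : fieldType.

Lemma wide_kernel m n (A : 'M[K]_(m, n)) : (n < m)%N ->
  exists2 c : 'rV_m, c != 0 & c *m A = 0.
Proof.
move=> nm; have /rowV0Pn[c /sub_kermxP cA c0] : kermx A != 0.
  by rewrite -mxrank_eq0 mxrank_ker subn_eq0 -ltnNge (leq_ltn_trans (rank_leq_col A)).
by exists c.
Qed.

Lemma size_monomial d N i j (p q u w : {poly K}) :
  (size p <= d.+1)%N -> (size q <= d.+1)%N ->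
  (size u <= d.+1)%N -> (size w <= d.+1)%N -> (i <= N)%N -> (j <= N)%N ->
  (size (p ^+ i * q ^+ (N - i) * (u ^+ j * w ^+ (N - j)))%R <= (2 * N * d).+1)%N.
Proof.
move=> sp sq su sw iN jN.
have mulS (a b : {poly K}) k l : (size a <= k.+1)%N -> (size b <= l.+1)%N ->
    (size (a * b)%R <= (k + l).+1)%N.
  by move=> ak bl; apply: leq_trans (size_polyMleq _ _) _; lia.
have expS (a : {poly K}) k : (size a <= d.+1)%N -> (size (a ^+ k)%R <= (k * d).+1)%N.
  move=> ad; elim: k => [|k IH]; first by rewrite expr0 size_poly1.
  by rewrite exprS mulSn; exact: mulS.
have -> : (2 * N * d = i * d + (N - i) * d + (j * d + (N - j) * d))%N.
  by rewrite -!mulnDl !subnKC // addnn -mul2n.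
exact: (mulS _ _ _ _ (mulS _ _ _ _ (expS _ _ sp) (expS _ _ sq))
                     (mulS _ _ _ _ (expS _ _ su) (expS _ _ sw))).
Qed.

(** Dimension count: after multiplication by [q ^+ N * w ^+ N] the [(N + 1)^2]
    monomials of degree at most [N] in each of [p / q] and [u / w] become
    polynomials of degree at most [2 N d], so for [N > 2 d] they are linearly
    dependent. *)
Lemma rational_functions_dependent (p q u w : {poly K}) :
  exists2 F : {poly {poly K}}, F != 0 &
    forall t, q.[t] != 0 -> w.[t] != 0 -> F.[p.[t] / q.[t], u.[t] / w.[t]] = 0.
Proof.
pose d := maxn (maxn (size p) (size q)) (maxn (size u) (size w)).
pose N := (2 * d).+1; pose n := N.+1.
(* The index [k] encodes the pair of exponents [(k %/ n, k %% n)]. *)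
pose M k := p ^+ (k %/ n) * q ^+ (N - k %/ n) * (u ^+ (k %% n) * w ^+ (N - k %% n)).
have divN (k : 'I_(n * n)) : (k %/ n <= N)%N by rewrite -ltnS ltn_divLR.
have modN k : (k %% n <= N)%N by rewrite -ltnS ltn_pmod.
have sM (k : 'I_(n * n)) : (size (M k) <= (2 * N * d).+1)%N.
  by apply: size_monomial => //; apply: leqW; rewrite !leq_max leqnn ?orbT.
have [|c c0 cM] := @wide_kernel (n * n) (2 * N * d).+1 (\matrix_(k, l) (M k)`_l).
  by rewrite /n /N; nia.
have cM0 : \sum_k c 0 k *: M k = 0.
  apply/polyP => l; rewrite coef0 coef_sum.
  have [lt|ge] := ltnP l (2 * N * d).+1; last first.
    by rewrite big1 // => k _; rewrite coefZ nth_default ?mulr0 // (leq_trans (sM k)).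
  have /rowP/(_ (Ordinal lt)) := cM; rewrite !mxE => cl.
  by rewrite -[RHS]cl; apply: eq_bigr => k _; rewrite coefZ mxE.
exists (\sum_k (c 0 k *: 'X^(k %% n))%:P * 'X^(k %/ n)).
  have [k0 ck0] : exists k, c 0 k != 0.
    by apply/existsP; rewrite -negb_forall; apply: contra c0 => /forallP z;
       apply/eqP/rowP => k; rewrite mxE; exact/eqP.
  apply: contraNneq ck0.
  move=> /(congr1 (fun F : {poly {poly K}} => F`_(k0 %/ n)`_(k0 %% n))).
  rewrite !coef0 coef_sum coef_sum (bigD1 k0) //= big1 ?addr0 => [|k kk0].
    by rewrite coefCM coefXn eqxx mulr1 coefZ coefXn eqxx mulr1 => ->.
  rewrite coefCM coefXn; case: eqP => [e1|_]; last by rewrite mulr0 coef0.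
  rewrite mulr1 coefZ coefXn; case: eqP => [e2|_]; last by rewrite mulr0.
  case/eqP: kk0; apply: val_inj => /=.
  by rewrite (divn_eq k n) (divn_eq k0 n) -e1 -e2.
move=> t qt wt; apply: (mulIf (mulf_neq0 (expf_neq0 N qt) (expf_neq0 N wt))).
rewrite mul0r -[RHS](horner0 t) -cM0 !horner_sum mulr_suml.
apply: eq_bigr => k _.
have clear_den (a b : K) i : b != 0 -> (i <= N)%N ->
    (a / b) ^+ i * b ^+ N = a ^+ i * b ^+ (N - i).
  move=> b0 iN; rewrite expr_div_n -{1}(subnK iN) exprD mulrACA mulVf ?mulr1 //.
  by rewrite expf_neq0.
rewrite hornerCM hornerXn -rmorphXn /= hornerM hornerC hornerZ hornerXn.
rewrite hornerZ /M !hornerM !horner_exp -!clear_den //; ring.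
Qed.

Lemma horner2_comp (F : {poly {poly K}}) (s : {poly K}) :
  (1 < size s)%N -> F != 0 ->
  exists2 F' : {poly {poly K}}, F' != 0 & forall x y, F'.[x, y] = F.[s.[x], s.[y]].
Proof.
move=> s1 F0; exists (map_poly (comp_poly s) F \Po map_poly polyC s).
  rewrite comp_poly_eq0 ?size_map_polyC // map_poly_eq0_id0 //.
  by rewrite comp_poly_eq0 // lead_coef_eq0.
move=> x y; rewrite horner_comp horner_map /=.
have := horner_map (comp_poly s) F s.[x]%:P; rewrite /= comp_polyC => ->.
by rewrite horner_comp.
Qed.

End AlgebraicDependence.

(** * The curve *)

Section Curve.
Variable C : numClosedFieldType.
Implicit Types (t r x : C) (p : C * C).
Local Notation v := (@zval C).

Lemma curve43_T t r : curve43 (t, r) -> v t branch != 0 ->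
  (T43 (t, r) - 1 / 2) ^+ 2 = fS t /\
  y43 (t, r) = 1 / 2 + (T43 (t, r) - 1 / 2) * fracG t.
Proof.
have A : v t fA = t + 2 by rewrite zval_lit /=; zK_literals; ring.
have B : v t fB = t + 7 by rewrite zval_lit /=; zK_literals; ring.
have H : v t fH = 3 * t ^+ 2 + 3 * t + 2 by rewrite zval_lit /=; zK_literals; ring.
have I : v t fI = t ^+ 2 + 1 by rewrite zval_lit /=; zK_literals; ring.
have E : v t fE = 5 * t ^+ 6 + 30 * t ^+ 5 + 45 * t ^+ 4 + 22 * t ^+ 3
    - 13 * t ^+ 2 - 16 * t - 9 by rewrite zval_lit /=; zK_literals; ring.
have N : v t numT = 27 * t ^+ 10 + 270 * t ^+ 9 + 945 * t ^+ 8 + 2160 * t ^+ 7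
    + 2745 * t ^+ 6 + 1926 * t ^+ 5 - 5 * t ^+ 4 - 1340 * t ^+ 3
    - 1440 * t ^+ 2 - 720 * t - 216.
  by rewrite zval_lit /=; zK_literals; ring.
have M : v t numy = 135 * t ^+ 9 + 540 * t ^+ 8 + 1530 * t ^+ 7
    + 2916 * t ^+ 6 + 3714 * t ^+ 5 + 3486 * t ^+ 4 + 2278 * t ^+ 3
    + 1144 * t ^+ 2 + 399 * t + 114.
  by rewrite zval_lit /=; zK_literals; ring.
rewrite /curve43 /= /T43 /y43 /= -N -M -E -A -B -H -I => rE /factors_neq0.
case/and5P=> b0 a0 m0 h0 /and5P[i0 k0 j0 g0 /and3P[e0 f0 N0]].
have r0 : r != 0.
  have : r ^+ 2 != 0 by rewrite rE !mulf_neq0 // pnatr_eq0.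
  by rewrite expf_eq0.
split.
  rewrite addrAC subrr add0r expr_div_n !exprMn rE /fS !zvalE; zK_literals; field.
  by rewrite a0 b0 h0 i0.
congr (_ + _).
rewrite [X in _ = X * _]addrAC subrr add0r /fracG !zvalE; zK_literals; field.
by rewrite a0 h0 i0 e0 N0 r0.
Qed.

Lemma finite_roots (q : {poly C}) : q != 0 -> finite_set [set x | root q x].
Proof.
move=> q0; have [rs qrs] := closed_field_poly_normal q.
apply: (sub_finite_set (B := [set` rs])); last exact: finite_seq.
by move=> x /=; rewrite qrs rootZ ?lead_coef_eq0 // root_prod_XsubC.
Qed.

(** The curve has finitely many points over each [t]. *)
Lemma generically_curve43 (q : {poly C}) (P : C * C -> Prop) : q != 0 ->
  (forall p, curve43 p -> q.[p.1] != 0 -> P p) -> generically (@curve43 C) P.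
Proof.
move=> q0 qP.
pose rhs t : C := 3 * (t + 2) * (t + 7) * (3 * t ^+ 2 + 3 * t + 2).
pose fiber t := [set r | root ('X^2 - (rhs t)%:P) r].
apply: (@sub_finite_set _ _
  (\bigcup_(t in [set t | root q t]) (pair t @` fiber t))).
  move=> [t r] [/= Xtr nP]; exists t.
    by apply: contrapT => /negP qt; apply: nP; exact: qP.
  by exists r => //; rewrite /fiber /= /root !hornerE subr_eq0; apply/eqP.
apply: bigcup_finite => [|t _]; first exact: finite_roots.
by apply/finite_image/finite_roots; rewrite -size_poly_eq0 size_XnsubC.
Qed.

Lemma infinite_curve43 : ~ finite_set (@curve43 C).
Proof.
move=> /(finite_image fst) fin.
have /finite_seqP[s sE] : finite_set [set: C].
  apply: sub_finite_set fin => t _.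
  exists (t, sqrtC (3 * (t + 2) * (t + 7) * (3 * t ^+ 2 + 3 * t + 2))) => //.
  by rewrite /curve43 /= sqrtCK.
have := @uniq_leq_size _ [seq n%:R : C | n <- iota 0 (size s).+1] s.
rewrite size_map size_iota ltnn => H; suff : false by [].
apply: H => [|x _]; last by have : [set: C] x by []; rewrite sE.
by rewrite map_inj_uniq ?iota_uniq //; exact: mulrIn.
Qed.

Lemma branch_neq0 : zpoly C branch != 0.
Proof.
suff : v 0 branch != 0 by apply: contraNneq => b0; rewrite /zval b0 horner0.
rewrite /branch !zvalE !zval_lit /= !mulr0 !add0r; zK_literals.
by rewrite !mulf_neq0 ?oppr_eq0 ?pnatr_eq0.
Qed.

(** If [T = c], then [t] is a root of [(T - 1/2)^2 - (c - 1/2)^2] cleared of its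
    denominator, a nonzero polynomial. *)
Lemma T43_nonconstant (c : C) : ~ generically (@curve43 C) (fun p => T43 p = c).
Proof.
move=> Tc; apply: infinite_curve43.
pose q := zpoly C numS - (c - 1 / 2) ^+ 2 *: zpoly C denS.
have qE t : q.[t] = v t numS - (c - 1 / 2) ^+ 2 * v t denS.
  by rewrite /q hornerD hornerN hornerZ.
have q0 : q != 0.
  (* [t = - 2] is a pole of [S]. *)
  suff : q.[- 2] != 0 by apply: contraNneq => ->; rewrite horner0.
  have A : v (- 2) fA = 0 by rewrite zval_lit /=; zK_literals; ring.
  have D : v (- 2) denS = 0 by rewrite !zvalE A; ring.
  rewrite qE D mulr0 subr0 zvalX.
  have N : v (- 2) numT = - (250 * 100) by rewrite zval_lit /=; zK_literals; ring.
  by rewrite N expf_neq0 // oppr_eq0 mulf_neq0 ?pnatr_eq0.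
have neqc : generically (@curve43 C) (fun p => T43 p != c).
  apply: (generically_curve43 (mulf_neq0 branch_neq0 q0)) => -[t r] Xtr.
  rewrite hornerM mulf_eq0 negb_or => /andP[gen qt].
  have [TS _] := curve43_T Xtr gen; apply: contraNneq qt => Tc'.
  rewrite qE -Tc' TS /fS.
  by rewrite divfK ?subrr ?denS_neq0.
have : finite_set ((@curve43 C `\` [set p | T43 p = c]) `|`
                   (@curve43 C `\` [set p | T43 p != c])).
  by rewrite finite_setU.
apply: sub_finite_set => p Xp.
have [e|e] := eqVneq (T43 p) c; [right | left]; split=> //=; last exact/eqP.
by rewrite e eqxx.
Qed.

(** A relation between [(T - 1/2)^2 = S] and [(y - 1/2)^2 = S G^2], rational
    functions of [t] alone, is one between [T] and [y]. *)
Lemma T43_y43_dependent : exists2 F : {poly {poly C}}, F != 0 &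
  forall t x, v t branch != 0 -> (x - 1 / 2) ^+ 2 = fS t ->
    F.[x, 1 / 2 + (x - 1 / 2) * fracG t] = 0.
Proof.
have [F0 F0n F0E] := rational_functions_dependent (zpoly C numS) (zpoly C denS)
  (zpoly C (numS * numG ^ 2)) (zpoly C (denS * denG ^ 2)).
have s2 : (1 < size (('X - (1 / 2)%:P) ^+ 2 : {poly C}))%N.
  by rewrite size_exp_XsubC.
have [F Fn FE] := horner2_comp s2 F0n; exists F => // t x gen xt.
rewrite FE !horner_exp !hornerXsubC addrAC subrr add0r exprMn xt.
have d0 : v t (denS * denG ^ 2) != 0.
  by rewrite !zvalM zvalX !mulf_neq0 ?expf_neq0 ?denS_neq0 ?denG_neq0.
rewrite -[RHS](F0E t (denS_neq0 gen) d0); congr _.[_, _].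
rewrite /fS /fracG -!/(zval t _) [in RHS]zvalM [in RHS]zvalM !zvalX.
by rewrite expr_div_n mulf_div.
Qed.

Theorem T43_y43_solution :
  parametrizes_algebraic_PVI_solution (1 / 3) (1 / 3) (1 / 2) (2 / 5)
    (@curve43 C) (@T43 C) (@y43 C).
Proof.
split; first exact: T43_nonconstant.
have [F Fn FE] := T43_y43_dependent; exists F => //.
apply: (generically_curve43 branch_neq0) => -[t0 r0] Xp gen0.
have [U [Y [[oU Ut0] genU solY YE]]] := local_solution gen0.
exists [set x | exists2 t, U t & (x - 1 / 2) ^+ 2 = fS t], Y.
have [TS _] := curve43_T Xp gen0.
split=> //; first by exists t0.
  by move=> x [t Ut xt]; rewrite (YE t) //; apply: FE => //; exact: genU.
rewrite near_withinE.
have : \forall q \near (t0, r0), U q.1.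
  have : nbhs t0 U by exact: open_nbhs_nbhs.
  exact: cvg_fst.
apply: filterS => -[t r] Ut Xtr.
have [TS' yT] := curve43_T Xtr (genU _ Ut).
split; first by exists t.
by rewrite yT (YE t).
Qed.

End Curve.

Theorem mainTheorem7 (R : realType) :
  @parametrizes_algebraic_PVI_solution R[i]
    (1 / 3) (1 / 3) (1 / 2) (2 / 5) (@curve43 R[i]) (@T43 R[i]) (@y43 R[i]).
Proof. exact: T43_y43_solution. Qed.
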